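(* Let $X$ be a complex Banach space and let $S,T\in B(X)$ be such that $ST=TS$, such that $N((TS)^p)=N(T^p)\oplus N(S^p)$ for all $p\in\mathbb{N}$, and such that $ST\in\tilde{\mathcal{F}}$. Let $\mathcal{R}$ be the set of all $\lambda\in\mathbb{C}$ for which the following implication holds: if $S+T-\lambda$ has finite ascent, then it is not true that both $(S-\lambda)(T-\lambda)=(T-\lambda)(S-\lambda)$ and $N\big(((T-\lambda)(S-\lambda))^p\big)=N((T-\lambda)^p)\oplus N((S-\lambda)^p)$ for all $p\in\mathbb{N}$. Then $$\mathcal{R}\cup\big(\sigma_{asc}(S+T)\setminus\{0\}\big)=\mathcal{R}\cup\big((\sigma_{asc}(S)\cup\sigma_{asc}(T))\setminus\{0\}\big).$$
   Context: $B(X)$ is the algebra of bounded linear operators on $X$, and $N(T)$, $R(T)$ denote the null space and range of $T$. $\mathbb{N}=\{0,1,2,\dots\}$. The ascent $asc(T)$ is the smallest $n\in\mathbb{N}$ with $N(T^n)=N(T^{n+1})$, and $asc(T)=\infty$ if no such $n$ exists. The ascent spectrum is $\sigma_{asc}(T)=\{\lambda\in\mathbb{C}: asc(T-\lambda)=\infty\}$, where $T-\lambda$ means $T-\lambda I$. $\tilde{\mathcal{F}}$ is the set of all $F\in B(X)$ for which there exists $n_0\in\mathbb{N}$ such that $F^{n_0}$ has finite rank. The symbol $\oplus$ denotes the (internal algebraic) direct sum of subspaces, so that the equality includes the requirement that the two summands intersect only in $\{0\}$. *)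

(* Defs.v *)
From HB Require Import structures.
From mathcomp Require Import all_boot all_order all_algebra.
From mathcomp Require Import complex.
From mathcomp Require Import all_classical all_reals all_analysis.
Import Order.TTheory GRing.Theory Num.Theory.
Import numFieldNormedType.Exports.

Set Implicit Arguments.
Unset Strict Implicit.
Unset Printing Implicit Defensive.

Local Open Scope classical_set_scope.
Local Open Scope complex_scope.
Local Open Scope ring_scope.

(* Operators are functions X -> X satisfying bounded_operator: the product
   TS is T \o S, the power T^n is iter n T (so T^0 = id), the sum is S \+ T. *)

Section Operators.
Context {R : realType} {X : completeNormedModType R[i]}.
Implicit Types (T F : X -> X) (U V W : set X).

(* For a linear map, being bounded near 0 is equivalent to the estimate
   |T x| <= M |x|; see linear_boundedP. *)
Definition bounded_operator : set (X -> X) :=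
  [set T | linear T /\ bounded_near T (nbhs (0 : X))].

Definition shift T (l : R[i]) : X -> X := fun x => T x - l *: x.

Definition null_space T : set X := [set x | T x = 0].

(* The infimum of a set of naturals is its minimum, and is +oo if it is empty. *)
Definition asc T : \bar R :=
  ereal_inf [set n%:R%:E | n in
    [set n : nat | null_space (iter n T) = null_space (iter n.+1 T)]].

Definition sigma_asc T : set R[i] := [set l | asc (shift T l) = +oo%E].

Definition span n (e : 'I_n -> X) : set X :=
  [set \sum_(i < n) c i *: e i | c in [set: 'I_n -> R[i]]].

Definition finite_rank F : Prop :=
  exists n (e : 'I_n -> X), range F = span e.

Definition power_finite_rank : set (X -> X) :=
  [set F | bounded_operator F /\ exists n0 : nat, finite_rank (iter n0 F)].

Definition is_direct_sum W U V : Prop :=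
  W = [set u + v | u in U & v in V] /\ U `&` V = [set 0].

Definition null_space_splitting (S T : X -> X) : Prop :=
  forall p : nat, is_direct_sum (null_space (iter p (T \o S)))
                                (null_space (iter p T))
                                (null_space (iter p S)).

Definition exceptional_set (S T : X -> X) : set R[i] :=
  [set l | asc (shift (S \+ T) l) <> +oo%E ->
           ~ (shift S l \o shift T l = shift T l \o shift S l /\
              null_space_splitting (shift S l) (shift T l))].

End Operators.

(* Main.v *)
(* If [l] lies outside the exceptional set then A = S + T - l has finite ascent,
   so for [l <> 0] it suffices to show that S - l and T - l have finite ascent.
   Their product D = ST - l A is a perturbation of -l A by the commuting
   operator K = ST, some power K^k of which has finite rank d.  If D^p x = 0
   then D^d K^k x = 0, because the D-orbit of K^k x stays in a d-dimensional
   space; hence y = D^d x is killed by K^k and by D^p, so by a power of A, so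
   by A^m where m is the ascent of A, and therefore by D^(m + k).  Thus D has
   finite ascent.  Finally, N((T-l)^p) and N((S-l)^p) are independent with sum
   N(D^p), so the ascents of both factors are at most that of D. *)
Require Import Defs.
From HB Require Import structures.
From mathcomp Require Import all_boot all_order all_algebra.
From mathcomp Require Import complex.
From mathcomp Require Import all_classical all_reals all_analysis.
Import Order.TTheory GRing.Theory Num.Theory.
Import numFieldNormedType.Exports.

Set Implicit Arguments.
Unset Strict Implicit.
Unset Printing Implicit Defensive.

Local Open Scope classical_set_scope.
Local Open Scope complex_scope.
Local Open Scope ring_scope.

(** One kernel N(f^n) containing all others replaces equality of consecutive kernels, so no least
    exponent has to be tracked; [asc_finiteP] links this form to [asc]. *)
Definition finite_ascent {V : nmodType} (f : V -> V) : Prop :=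
  exists n : nat, forall p x, iter p f x = 0 -> iter n f x = 0.

Lemma iter_commute {V : Type} (f g : V -> V) p x :
  (forall y, f (g y) = g (f y)) -> iter p f (g x) = g (iter p f x).
Proof. by move=> fg; elim: p => //= p ->. Qed.

Lemma iter_commute2 {V : Type} (f g : V -> V) p q x :
  (forall y, f (g y) = g (f y)) ->
  iter p f (iter q g x) = iter q g (iter p f x).
Proof.
by move=> fg; apply: iter_commute => y; rewrite [RHS]iter_commute.
Qed.

Section LinearIterates.
Context {F : fieldType} {V : lmodType F}.
Implicit Types f g h : {linear V -> V}.

Lemma iter_linear0 f n : iter n f 0 = 0.
Proof. by elim: n => //= n ->; rewrite linear0. Qed.

Lemma iter_linearP f n : linear (iter n f).
Proof. by move=> a x y; elim: n => //= n ->; rewrite linearP. Qed.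

Lemma iter_linear_sum f n k (c : 'I_k -> F) (v : 'I_k -> V) :
  iter n f (\sum_i c i *: v i) = \sum_i c i *: iter n f (v i).
Proof.
elim: n => //= n ->; rewrite linear_sum.
by apply: eq_bigr => i _; rewrite linearZ.
Qed.

Lemma iter_eq0_leq f m n x : (m <= n)%N -> iter m f x = 0 -> iter n f x = 0.
Proof. by move=> /subnK <- fx0; rewrite iterD fx0 iter_linear0. Qed.

(** In the binomial expansion of (af + bg)^(p+q) every term contains f^p or g^q. The induction on p
    + q peels off one [h]: applying [f] or [g] to [x] lowers [p] or [q] by one. *)
Lemma iter_lincomb_eq0 f g h (a b : F) p q x :
    (forall y, f (g y) = g (f y)) ->
    (forall y, h y = a *: f y + b *: g y) ->
  iter p f x = 0 -> iter q g x = 0 -> iter (p + q) h x = 0.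
Proof.
move=> fg hE; have [n nE] : exists n, n = (p + q)%N by exists (p + q)%N.
rewrite -nE; elim: n p q x nE => [|n IHn] p q x nE fx0 gx0.
  by move: nE fx0; case: p.
case: p q nE fx0 gx0 => [|p] [|q] nE fx0 gx0;
  try by rewrite ?[x]fx0 ?[x]gx0 iter_linear0.
rewrite iterSr hE iter_linearP.
have -> : iter n h (f x) = 0.
  apply: (IHn p q.+1); [by case: nE| by rewrite -iterSr|].
  by rewrite iter_commute ?gx0 ?linear0.
rewrite scaler0 add0r -[b *: _]addr0 iter_linearP iter_linear0 addr0.
rewrite (IHn p.+1 q) ?scaler0 -?iterSr //.
  by move: nE; rewrite addnS; case.
by rewrite iter_commute ?fx0 ?linear0.
Qed.

(** The coefficient matrix has more rows than columns, hence a nonzero row vector in its left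
    kernel. *)
Lemma span_dependent n (e : 'I_n -> V) (v : 'I_n.+1 -> V) :
    (forall i, exists c : 'I_n -> F, v i = \sum_j c j *: e j) ->
  exists2 c : 'I_n.+1 -> F, \sum_i c i *: v i = 0 & exists i, c i != 0.
Proof.
move=> /choice[c vE]; pose M := \matrix_(i, j) c i j.
have : ~~ row_free M by rewrite /row_free neq_ltn ltnS rank_leq_col.
rewrite -kermx_eq0 => /rowV0Pn[u /sub_kermxP uM0 /rV0Pn[i ui]].
exists (u 0); last by exists i.
transitivity (\sum_j (u *m M) 0 j *: e j); last first.
  by rewrite uM0; apply: big1 => j _; rewrite mxE scale0r.
under eq_bigr do rewrite vE scaler_sumr.
rewrite exchange_big; apply: eq_bigr => j _; rewrite mxE scaler_suml.
by apply: eq_bigr => k _; rewrite mxE scalerA.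
Qed.

(** A linear relation among x, f x, ..., f^n x allows any annihilating exponent above [n] to be
    lowered by one. *)
Lemma iter_eq0_span f n (e : 'I_n -> V) x p :
    (forall i, exists c : 'I_n -> F, iter i f x = \sum_j c j *: e j) ->
  iter p f x = 0 -> iter n f x = 0.
Proof.
move=> x_e; elim: p => [x0|p IHp fx0]; first exact: (@iter_eq0_leq f 0).
have [pn|np] := ltnP p n; first exact: iter_eq0_leq fx0.
apply: IHp.
have [c c0 [i0 ci0]] := span_dependent (fun i : 'I_n.+1 => x_e i).
pose i := [arg min_(i < i0 | c i != 0%R) (i : nat)]%N.
have [ci imin] : c i != 0 /\ forall j, c j != 0 -> (i <= j)%N.
  by rewrite /i; case: arg_minnP.
have ip : (i <= p)%N by rewrite (leq_trans _ np) // -ltnS ltn_ord.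
(* With [i] the least index of a nonzero coefficient, f^(p-i) turns term [i] into a multiple of f^p
   x and kills the later terms, as f^(p+1) x = 0. *)
have := congr1 (iter (p - i) f) c0.
rewrite iter_linear0 iter_linear_sum (bigD1 i) //= -iterD subnK //.
rewrite big1 => [|j ji].
  by move/eqP; rewrite addr0 scaler_eq0 (negPf ci) => /eqP.
have [->|cj] := eqVneq (c j) 0; first by rewrite scale0r.
rewrite -iterD (@iter_eq0_leq f p.+1) ?scaler0 //.
rewrite -{1}(subnK ip) -addnS leq_add2l ltn_neqAle imin // andbT.
by rewrite eq_sym.
Qed.

Lemma finite_ascent_perturbation f g h (a b : F) k n (e : 'I_n -> V) :
    a != 0 -> (forall y, f (g y) = g (f y)) ->
    (forall y, h y = a *: f y + b *: g y) ->
    (forall x, exists c : 'I_n -> F, iter k g x = \sum_j c j *: e j) ->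
  finite_ascent f -> finite_ascent h.
Proof.
(* The first [n] factors of [h] bring [x] into N(g^k); the other m + k finish by
   [iter_lincomb_eq0]. *)
move=> a0 fg hE g_e [m fm]; exists (m + k + n)%N => p x hx0.
have hg y : h (g y) = g (h y) by rewrite !hE fg linearD !linearZ.
have fE y : f y = a^-1 *: h y + - (a^-1 * b) *: g y.
  by rewrite hE scalerDr !scalerA mulVf // scale1r scaleNr addrK.
(* Since [h] commutes with [g], h^i (g^k x) = g^k (h^i x) stays in the span of [e]. *)
have gk0 : iter k g (iter n h x) = 0.
  rewrite -iter_commute2 //; apply: (@iter_eq0_span _ _ e _ p) => [i|].
    by rewrite iter_commute2.
  by rewrite iter_commute2 // hx0 iter_linear0.
rewrite iterD; apply: (iter_lincomb_eq0 fg hE _ gk0).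
apply: (fm (p + k)%N); apply: (iter_lincomb_eq0 hg fE _ gk0).
by rewrite iter_commute2 // hx0 iter_linear0.
Qed.

End LinearIterates.

Section Operators.
Context {R : realType} {X : completeNormedModType R[i]}.
Implicit Types (S T : {linear X -> X}) (l : R[i]).

Lemma asc_finiteP T : asc T <> +oo%E <-> finite_ascent T.
Proof.
split=> [ascT|[n Tn]].
  have [[n Tn]|noT] := pselect (exists n : nat,
      null_space (iter n T) = null_space (iter n.+1 T)); last first.
    case: ascT; rewrite /asc; set A := (X in image X _).
    suff -> : A = set0 by rewrite image_set0 ereal_inf0.
    by apply/seteqP; split=> // n An; apply: noT; exists n.
  exists n => p x; elim: p => [x0|p IHp Tx0].
    exact: (@iter_eq0_leq _ _ T 0%N).
  have [pn|np] := ltnP p n; first exact: iter_eq0_leq Tx0.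
  (* T^(p-n) x lies in N(T^(n+1)) = N(T^n), so already T^p x = 0. *)
  have : null_space (iter n.+1 T) (iter (p - n) T x).
    by rewrite /null_space /= -iterS -iterD addSn subnKC.
  by rewrite -Tn /null_space /= -iterD subnKC.
have Tnn : null_space (iter n T) = null_space (iter n.+1 T).
  apply/seteqP; split=> x; last exact: Tn.
  exact: iter_eq0_leq.
have : (asc T <= n%:R%:E)%E by apply: ereal_inf_lbound; exists n.
by move=> + ascT; rewrite ascT.
Qed.

Lemma shift_linear T l : linear (Defs.shift T l).
Proof.
move=> a x y; rewrite /Defs.shift linearP scalerDr scalerBr opprD addrACA.
by rewrite !scalerA mulrC.
Qed.

HB.instance Definition _ T l :=
  GRing.isLinear.Build R[i] X X *:%R (Defs.shift T l) (shift_linear T l).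

Lemma splitting_finite_ascent S T :
    S \o T = T \o S -> null_space_splitting S T ->
  finite_ascent (T \o S) -> finite_ascent S /\ finite_ascent T.
Proof.
move=> ST split_ST [n TSn].
have TSC y : T (S y) = S (T y) by have /(congr1 (@^~ y)) := ST.
have decomp p x : iter p (T \o S) x = 0 ->
    exists u v, [/\ x = u + v, iter n T u = 0 & iter n S v = 0].
  move=> /TSn; have [/seteqP[sub _] _] := split_ST n.
  by move=> /sub[u Tu [v Sv <-]]; exists u, v.
have disj p x : iter p T x = 0 -> iter p S x = 0 -> x = 0.
  move=> Tx Sx; have [_ /seteqP[sub _]] := split_ST p.
  exact: sub.
have iterM p x : iter p (T \o S) x = iter p T (iter p S x).
  elim: p x => // p IHp x; rewrite iterSr IHp /=.
  by rewrite [iter p S (T _)]iter_commute // -iterSr -iterSr.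
have iterB (f : {linear X -> X}) p x y :
    iter p f (x - y) = iter p f x - iter p f y.
  by rewrite addrC -scaleN1r iter_linearP scaleN1r addrC.
split; exists n => p x x0.
  have [|u [v [xE Tu Sv]]] := decomp p x.
    by rewrite iterM x0 iter_linear0.
  suff u0 : u = 0 by rewrite xE u0 add0r.
  (* Independence is given only for equal exponents. Both kernels at n + p contain u = x - v, since
     S^p x = 0 and S^n v = 0. *)
  apply: (disj (n + p)%N); first exact: iter_eq0_leq (leq_addr _ _) Tu.
  have -> : u = x - v by rewrite xE addrK.
  rewrite iterB (iter_eq0_leq (leq_addl _ _) x0).
  by rewrite (iter_eq0_leq (leq_addr _ _) Sv) subr0.
have [|u [v [xE Tu Sv]]] := decomp p x.
  by rewrite iterM iter_commute2 // x0 iter_linear0.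
suff v0 : v = 0 by rewrite xE v0 addr0.
apply: (disj (n + p)%N); last exact: iter_eq0_leq (leq_addr _ _) Sv.
have -> : v = x - u by rewrite xE addrC addKr.
rewrite iterB (iter_eq0_leq (leq_addl _ _) x0).
by rewrite (iter_eq0_leq (leq_addr _ _) Tu) subr0.
Qed.

Lemma shift_finite_ascent S T l :
    l != 0 -> S \o T = T \o S -> (exists k, finite_rank (iter k (S \o T))) ->
    Defs.shift S l \o Defs.shift T l = Defs.shift T l \o Defs.shift S l ->
    null_space_splitting (Defs.shift S l) (Defs.shift T l) ->
    finite_ascent (Defs.shift (S \+ T) l) ->
  finite_ascent (Defs.shift S l) /\ finite_ascent (Defs.shift T l).
Proof.
move=> l0 ST [k [n [e rangeE]]] STl split_l ascST.
have STC y : S (T y) = T (S y) by have /(congr1 (@^~ y)) := ST.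
apply: splitting_finite_ascent => //.
(* The identity behind this is (T - l)(S - l) = -l (S + T - l) + ST. *)
apply: (@finite_ascent_perturbation _ _ (Defs.shift (S \+ T) l) (S \o T) _
  (- l) 1 k n e) => //.
- by rewrite oppr_eq0.
- by move=> y; rewrite /= /Defs.shift /= !linearB !linearD !linearZ /= !STC.
- move=> y; rewrite /= /Defs.shift /= linearB linearZ /= STC scale1r.
  rewrite [RHS]addrC -addrA; congr (_ + _).
  by rewrite scaleNr -opprD -scalerDr addrA [T y + S y]addrC.
- move=> x; have : range (iter k (S \o T)) (iter k (S \o T) x) by exists x.
  by rewrite rangeE => -[c _ <-]; exists c.
Qed.

End Operators.

Theorem theorem1p4 (R : realType) (X : completeNormedModType R[i])
    (S T : X -> X) (hS : bounded_operator S) (hT : bounded_operator T)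
    (hcomm : S \o T = T \o S) (hker : null_space_splitting S T)
    (hST : power_finite_rank (S \o T)) :
  exceptional_set S T `|` (sigma_asc (S \+ T) `\` [set 0]) =
  exceptional_set S T `|` ((sigma_asc S `|` sigma_asc T) `\` [set 0]).
Proof.
have [_ rankST] := hST.
pose S' : {linear X -> X} := HB.pack S (GRing.isLinear.Build _ _ _ _ S hS.1).
pose T' : {linear X -> X} := HB.pack T (GRing.isLinear.Build _ _ _ _ T hT.1).
suff nonexc l : l != 0 -> ~ exceptional_set S T l ->
    ~ sigma_asc S l /\ ~ sigma_asc T l.
  apply/seteqP; split=> l [excl|[ascl /eqP l0]]; [by left| |by left|].
    (* If S + T - l has infinite ascent, the implication defining the exceptional set is vacuous, so
       this inclusion is immediate. *)
    by left=> ascST; case: ascST.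
  have [|/(nonexc _ l0)[nS nT]] := pselect (exceptional_set S T l).
    by left.
  by case: ascl => [/nS|/nT].
move=> l0 /not_implyP[ascST /contrapT[STl split_l]].
have [ascS ascT] := @shift_finite_ascent R X S' T' l l0 hcomm rankST STl
  split_l ((asc_finiteP (Defs.shift (S' \+ T') l)).1 ascST).
split=> //; first exact/(asc_finiteP (Defs.shift S' l)).
exact/(asc_finiteP (Defs.shift T' l)).
Qed.
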